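(* Let $n\geq 2$ be an integer and let $L$ be a quasigroup of order $n$ with underlying set $I_n=\{1,2,\ldots,n\}$, whose product of $x$ and $y$ is written $xy$. Let $\Gamma_1$ be the digraph with vertex set $I_n\times I_n\times\mathbb{Z}_2$ whose darts (arcs) are exactly the following: \begin{itemize} \item $(x,y,i)\mapsto(z,y,i)$ for all $i\in\mathbb{Z}_2$, $x,y,z\in I_n$, $x\neq z$; \item $(x,y,i)\mapsto(x,z,i)$ for all $i\in\mathbb{Z}_2$, $x,y,z\in I_n$, $y\neq z$; \item $(x,y,0)\mapsto(xy,z,1)$ for all $x,y,z\in I_n$; \item $(x,y,1)\mapsto(z,yx,0)$ for all $x,y,z\in I_n$. \end{itemize} Then $\Gamma_1$ is a directed strongly regular graph with parameter set $(2n^2,\,3n-2,\,2n-1,\,n-1,\,3)$.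
   Context: A quasigroup is a set $Q$ with a binary operation such that for all $a,b\in Q$ each of the equations $ax=b$ and $ya=b$ has a unique solution in $Q$; equivalently, its multiplication table is a Latin square, $xy$ being the symbol in row $x$ and column $y$. (In particular loops, i.e. quasigroups with an identity element, are allowed.) A directed strongly regular graph (DSRG) with parameter set $(N,k,t,\lambda,\mu)$ (in this order) is a loopless directed graph on $N$ vertices that is regular of valency $k$ (every vertex has in-degree and out-degree $k$), such that every vertex is incident with exactly $t$ undirected edges (an undirected edge is a pair of opposite arcs), and for any two distinct vertices $x,y$ the number of directed paths of length 2 from $x$ to $y$ is $\lambda$ if there is an arc from $x$ to $y$ and $\mu$ otherwise. Equivalently, its adjacency matrix $A$ (with zero diagonal) satisfies $AJ=JA=kJ$ and $A^2=tI+\lambda A+\mu(J-I-A)$, where $J$ is the all-one matrix and $I$ the identity matrix. *)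

(* Defs.v *)
From mathcomp Require Import all_boot all_order all_algebra.

Set Implicit Arguments.
Unset Strict Implicit.
Unset Printing Implicit Defensive.

Definition is_quasigroup (Q : Type) (op : Q -> Q -> Q) : Prop :=
  forall a b : Q, (exists! x, op a x = b) /\ (exists! y, op y a = b).

Record is_DSRG (V : finType) (arc : rel V) (N k t lambda mu : nat) : Prop := {
  DSRG_order : #|V| = N;
  DSRG_loopless : forall x, ~~ arc x x;
  DSRG_outdegree : forall x, #|[set y | arc x y]| = k;
  DSRG_indegree : forall x, #|[set y | arc y x]| = k;
  DSRG_undirected : forall x, #|[set y | arc x y && arc y x]| = t;
  DSRG_paths : forall x y, x != y ->
    #|[set z | arc x z && arc z y]| = if arc x y then lambda else mu
}.

(* The symbols 1, ..., n are represented by the elements of 'I_n. *)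
Definition Gamma1_vertex (n : nat) : finType := ('I_n * 'I_n * 'Z_2)%type.

Definition Gamma1 (n : nat) (op : 'I_n -> 'I_n -> 'I_n) : rel (Gamma1_vertex n) :=
  fun u v =>
  [|| [exists i : 'Z_2, exists x : 'I_n, exists y : 'I_n, exists z : 'I_n,
         [&& x != z, u == (x, y, i) & v == (z, y, i)]],
      [exists i : 'Z_2, exists x : 'I_n, exists y : 'I_n, exists z : 'I_n,
         [&& y != z, u == (x, y, i) & v == (x, z, i)]],
      [exists x : 'I_n, exists y : 'I_n, exists z : 'I_n,
         (u == (x, y, 0%R)) && (v == (op x y, z, 1%R))]
    | [exists x : 'I_n, exists y : 'I_n, exists z : 'I_n,
         (u == (x, y, 1%R)) && (v == (z, op y x, 0%R))]].

(* Main.v *)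
Require Import Defs.
From mathcomp Require Import all_boot all_order all_algebra.
From mathcomp Require Import zify.

Set Implicit Arguments.
Unset Strict Implicit.
Unset Printing Implicit Defensive.

(** [Gamma1] restricted to a layer is the rook graph of the [n] by [n] board, and
the layers are joined by the quasigroup.  A path of length 2 that stays in a
layer is a path of the rook graph; the paths that leave a layer are counted by
rows and columns of the board and by the unique solvability of the equations
[ax = b] and [ya = b].  The map [(x, y, i) |-> (y, x, i + 1)] is an
automorphism, so that only paths starting in layer 0 need to be considered. *)

Section Rook.
Variable n : nat.
Implicit Types (x y a b : 'I_n) (F : 'I_n -> 'I_n -> nat).

(** The exclusive or asks that exactly one coordinate agree, so a square is not adjacent to
    itself. *)
Definition rook x y a b := (x == a) (+) (y == b).

Lemma rookC x y a b : rook x y a b = rook a b x y.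
Proof. by rewrite /rook (eq_sym x) (eq_sym y). Qed.

Lemma sum_delta x (f : 'I_n -> nat) : \sum_a (x == a) * f a = f x.
Proof.
rewrite (bigD1 x) //= eqxx mul1n big1 ?addn0 // => a.
by rewrite eq_sym => /negbTE->.
Qed.

(* Stated additively to avoid truncated subtraction. *)
Lemma sum_rook x y F :
  \sum_a \sum_b rook x y a b * F a b + 2 * F x y = \sum_b F x b + \sum_a F a y.
Proof.
(* In a single row [a]: the exclusive or of two bits is their sum minus twice their product. *)
have inner a : \sum_b rook x y a b * F a b + 2 * ((x == a) * F a y) =
    (x == a) * (\sum_b F a b) + F a y.
  rewrite -{2}(sum_delta y (F a)) big_distrr /= -big_split /=.
  rewrite -(sum_delta y (fun b => 2 * ((x == a) * F a b))) -big_split /=.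
  by apply: eq_bigr => b _; rewrite /rook; case: (x == a); case: (y == b) => /=; lia.
rewrite -(sum_delta x (fun a => \sum_b F a b)) -big_split /=.
rewrite -(sum_delta x (fun a => 2 * F a y)) -big_split /=.
by apply: eq_bigr => a _; rewrite -inner mulnCA.
Qed.

(** On a line through a given square all the other squares are its neighbours; on a parallel line
    only the crossing with the perpendicular through it is. *)
Lemma sum_addb (c : bool) y : \sum_b (c (+) (b == y)) = if c then n - 1 else 1.
Proof.
have sum_eq : \sum_b (b == y) = 1.
  rewrite -[RHS](sum_delta y (fun=> 1)).
  by apply: eq_bigr => b _; rewrite eq_sym muln1.
case: c => /=; last exact: sum_eq.
have: \sum_b (b != y) + \sum_b (b == y) = n.
  rewrite -big_split /= (eq_bigr (fun=> 1)) => [|b _]; last by case: (b == y).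
  by rewrite sum1_card card_ord.
by rewrite sum_eq => /(canRL (addnK 1)).
Qed.

Lemma sum_rook_row x a b : \sum_y rook x y a b = if x == a then n - 1 else 1.
Proof. exact: sum_addb. Qed.

Lemma sum_rook_col y a b : \sum_x rook x y a b = if y == b then n - 1 else 1.
Proof. by rewrite -(sum_addb _ a); apply: eq_bigr => x _; rewrite /rook addbC. Qed.

Lemma rook_degree x y : \sum_a \sum_b rook x y a b = 2 * n - 2.
Proof.
have := sum_rook x y (fun _ _ => 1).
rewrite !sum_nat_const !card_ord muln1.
under eq_bigr do under eq_bigr do rewrite muln1.
lia.
Qed.

(** Neighbours of [(a, b)] are counted along row [x] and column [y]. Adjacent squares give
    [(n - 1) + 1], less 2 for [(x, y)] itself, counted twice; the others give [1 + 1]. *)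
Lemma rook_paths x y a b : 1 < n -> (x, y) != (a, b) ->
  \sum_c \sum_d rook x y c d * rook c d a b = if rook x y a b then n - 2 else 2.
Proof.
move=> n_gt1; rewrite xpair_eqE => neq.
have := sum_rook x y (fun c d => rook c d a b).
rewrite sum_rook_row sum_rook_col.
by move: neq; rewrite /rook; case: eqP; case: eqP => //= _ _ _; lia.
Qed.

End Rook.


Lemma Z2P (i : 'Z_2) : i = 0%R \/ i = 1%R.
Proof. by case: i => -[|[|//]] lt_i; [left | right]; apply: val_inj. Qed.

Section Gamma1.
Variables (n : nat) (op : 'I_n -> 'I_n -> 'I_n).
Implicit Types (x y a b : 'I_n) (i j : 'Z_2).

(** Eliminates the existentials of the dart rules, so that arcs can be counted by sums of
    booleans. *)
Lemma Gamma1E x y i a b j :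
  Gamma1 op (x, y, i) (a, b, j) =
    if i == j then rook x y a b
    else if i == 0%R then op x y == a else op y x == b.
Proof.
apply/idP/idP.
  case/or4P.
  - case/existsP=> k /existsP[c /existsP[d /existsP[e]]].
    case/and3P=> neq /eqP[-> -> ->] /eqP[-> -> ->].
    by rewrite eqxx /rook eqxx (negbTE neq).
  - case/existsP=> k /existsP[c /existsP[d /existsP[e]]].
    case/and3P=> neq /eqP[-> -> ->] /eqP[-> -> ->].
    by rewrite eqxx /rook eqxx (negbTE neq).
  - case/existsP=> c /existsP[d /existsP[e]].
    by case/andP=> /eqP[-> -> ->] /eqP[-> -> ->] /=.
  case/existsP=> c /existsP[d /existsP[e]].
  by case/andP=> /eqP[-> -> ->] /eqP[-> -> ->] /=.
case: ifPn => [/eqP<-|neq_ij].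
  rewrite /rook; case: (eqVneq x a) => [<-|neq] /=.
    move=> neq; apply/or4P; apply: Or42.
    apply/existsP; exists i; apply/existsP; exists x.
    by apply/existsP; exists y; apply/existsP; exists b; rewrite neq !eqxx.
  move/eqP=> <-; apply/or4P; apply: Or41.
  apply/existsP; exists i; apply/existsP; exists x.
  by apply/existsP; exists y; apply/existsP; exists a; rewrite neq !eqxx.
case: (Z2P i) (Z2P j) neq_ij => -> [] -> //= _ /eqP <-; apply/or4P.
  apply: Or43; apply/existsP; exists x; apply/existsP; exists y.
  by apply/existsP; exists b; rewrite !eqxx.
apply: Or44; apply/existsP; exists x; apply/existsP; exists y.
by apply/existsP; exists a; rewrite !eqxx.
Qed.

Definition flip (v : Gamma1_vertex n) : Gamma1_vertex n :=
  (v.1.2, v.1.1, (v.2 + 1)%R).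

Lemma flipK : involutive flip.
Proof.
by case=> [[x y] i]; rewrite /flip /=; case: (Z2P i) => ->; congr (_, _); apply: val_inj.
Qed.

(** Transposing the board preserves rook adjacency and exchanges the two rules that join the
    layers. *)
Lemma Gamma1_flip u v : Gamma1 op (flip u) (flip v) = Gamma1 op u v.
Proof.
case: u v => [[x y] i] [[a b] j]; rewrite !Gamma1E /rook addbC.
by case: (Z2P i) => ->; case: (Z2P j) => ->.
Qed.

Lemma card_flip (P Q : pred (Gamma1_vertex n)) :
  (forall v, P (flip v) = Q v) -> #|[set v | P v]| = #|[set v | Q v]|.
Proof.
move=> PQ; rewrite -[LHS](card_imset _ (can_inj flipK)); apply: eq_card => v.
apply/imsetP/idP => [[u]|].
  by rewrite !inE => Pu ->; rewrite -PQ flipK.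
by rewrite !inE -PQ => Pv; exists (flip v); rewrite ?inE ?flipK.
Qed.

Lemma flip_ind (P : Gamma1_vertex n -> Prop) :
  (forall x y, P (x, y, 0%R)) -> (forall v, P (flip v) -> P v) -> forall v, P v.
Proof.
move=> P0 Pflip [[x y] i]; case: (Z2P i) => ->; first exact: P0.
apply: Pflip; rewrite /flip /=.
by have -> : (1 + 1 = 0 :> 'Z_2)%R by apply: val_inj.
Qed.

Lemma card_layers (P : pred (Gamma1_vertex n)) (F0 F1 : 'I_n -> 'I_n -> nat) :
  (forall a b, P (a, b, 0%R) = F0 a b :> nat) ->
  (forall a b, P (a, b, 1%R) = F1 a b :> nat) ->
  #|[set v | P v]| = \sum_a \sum_b F0 a b + \sum_a \sum_b F1 a b.
Proof.
move=> PF0 PF1; rewrite !pair_bigA -big_split cardsE -sum1_card big_mkcond /=.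
rewrite (eq_bigr (fun v : 'I_n * 'I_n * 'Z_2 => P (v.1, v.2) : nat)); last first.
  by case=> p i _; rewrite unfold_in; case: (P _).
rewrite -(pair_bigA _ (fun p i => P (p, i) : nat)) /=.
apply: eq_bigr => -[a b] _; rewrite big_ord_recl big_ord1 /= -PF0 -PF1.
by congr (nat_of_bool (P (_, _)) + nat_of_bool (P (_, _))); apply: val_inj.
Qed.

Hypothesis n_gt1 : 1 < n.
Hypothesis qop : is_quasigroup op.

Lemma sum_exists_unique (f : 'I_n -> 'I_n) b :
  (exists! x, f x = b) -> \sum_x (f x == b) = 1.
Proof.
case=> c [fc uc]; rewrite -(sum_delta c (fun=> 1)).
apply: eq_bigr => x _; rewrite muln1; congr nat_of_bool.
by apply/eqP/eqP => [/uc | <-].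
Qed.

Lemma sum_ldiv a b : \sum_x (op a x == b) = 1.
Proof. by apply: sum_exists_unique; case: (qop a b). Qed.

Lemma sum_rdiv a b : \sum_x (op x a == b) = 1.
Proof. by apply: (@sum_exists_unique (op^~ a)); case: (qop a b). Qed.

(** The out-neighbours of [(x, y, 0)] in layer 1 fill row [op x y], so sums over them collapse to
    that row. *)
Lemma sum_row c (F : 'I_n -> 'I_n -> nat) :
  \sum_a \sum_b (c == a) * F a b = \sum_b F c b.
Proof.
rewrite -(sum_delta c (fun a => \sum_b F a b)).
by apply: eq_bigr => a _; rewrite big_distrr.
Qed.

Lemma Gamma1_order : #|Gamma1_vertex n| = 2 * n ^ 2.
Proof. by rewrite !card_prod !card_ord mulnC -mulnn. Qed.

Lemma Gamma1_loopless v : ~~ Gamma1 op v v.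
Proof. by case: v => [[x y] i]; rewrite Gamma1E /rook !eqxx. Qed.

Lemma Gamma1_outdegree v : #|[set w | Gamma1 op v w]| = 3 * n - 2.
Proof.
move: v; apply: flip_ind => [x y|v <-]; last first.
  by apply/esym/card_flip => w; rewrite Gamma1_flip.
rewrite (card_layers (F0 := fun a b => rook x y a b)
                     (F1 := fun a b => (op x y == a) * 1)) => [|a b|a b].
- by rewrite rook_degree (sum_row _ (fun _ _ => 1)) sum_nat_const card_ord; lia.
- by rewrite Gamma1E.
- by rewrite Gamma1E muln1.
Qed.

Lemma Gamma1_indegree v : #|[set w | Gamma1 op w v]| = 3 * n - 2.
Proof.
move: v; apply: flip_ind => [x y|v <-]; last first.
  by apply/esym/card_flip => w; rewrite Gamma1_flip.
rewrite (card_layers (F0 := fun a b => rook x y a b)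
                     (F1 := fun a b => op b a == y)) => [|a b|a b].
(* Each of the [n] rows of layer 1 holds exactly one in-neighbour. *)
- rewrite rook_degree (eq_bigr (fun=> 1)) => [|a _]; last exact: sum_rdiv.
  by rewrite sum_nat_const card_ord; lia.
- by rewrite Gamma1E rookC.
- by rewrite Gamma1E.
Qed.

Lemma Gamma1_undirected v :
  #|[set w | Gamma1 op v w && Gamma1 op w v]| = 2 * n - 1.
Proof.
move: v; apply: flip_ind => [x y|v <-]; last first.
  by apply/esym/card_flip => w; rewrite !Gamma1_flip.
rewrite (card_layers (F0 := fun a b => rook x y a b)
          (F1 := fun a b => (op x y == a) * (op b a == y))) => [|a b|a b].
(* All [2 * n - 2] rook edges are undirected; in row [op x y] of layer 1 exactly one vertex has an
   arc back. *)
- by rewrite rook_degree (sum_row _ (fun a b => op b a == y)) sum_rdiv; lia.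
- by rewrite !Gamma1E /= (rookC a) andbb.
- by rewrite !Gamma1E mulnb.
Qed.

Lemma Gamma1_paths u v : u != v ->
  #|[set w | Gamma1 op u w && Gamma1 op w v]|
    = if Gamma1 op u v then n - 1 else 3.
Proof.
move: u v; apply: flip_ind => [x y|u IH v neq_uv]; last first.
  rewrite -(Gamma1_flip u v) -(IH (flip v)); last by rewrite (inj_eq (can_inj flipK)).
  by apply/esym/card_flip => w; rewrite !Gamma1_flip.
case=> [[a b] j]; case: (Z2P j) => -> neq; rewrite Gamma1E /=.
  rewrite (card_layers (F0 := fun c d => rook x y c d * rook c d a b)
            (F1 := fun c d => (op x y == c) * (op d c == b))) => [|c d|c d].
  (* Exactly one path goes through layer 1, raising the rook counts [n - 2] and [2] to [n - 1] and
     [3]. *)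
  - rewrite (sum_row _ (fun c d => op d c == b)) sum_rdiv rook_paths //.
      by case: (rook _ _ _ _); lia.
    by apply: contra neq => /eqP[-> ->].
  - by rewrite !Gamma1E mulnb.
  - by rewrite !Gamma1E mulnb.
rewrite (card_layers (F0 := fun c d => rook x y c d * (op c d == a))
          (F1 := fun c d => (op x y == c) * rook c d a b)) => [|c d|c d].
(* If [op x y = a], the symbol [a] occurs at no rook neighbour of [(x, y)], and layer 1 gives
   [n - 1] paths. Otherwise [a] occurs once in row [x] and once in column [y], and layer 1 gives one
   more. *)
- rewrite (sum_row _ (fun c d => rook c d a b)) sum_rook_row.
  have := sum_rook x y (fun c d => op c d == a).
  by rewrite sum_ldiv sum_rdiv; case: (op x y == a); lia.
- by rewrite !Gamma1E mulnb.
- by rewrite !Gamma1E mulnb.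
Qed.

End Gamma1.

Theorem theorem4p1 (n : nat) (hn : 2 <= n) (op : 'I_n -> 'I_n -> 'I_n)
    (hop : is_quasigroup op) :
  is_DSRG (Gamma1 op) (2 * n ^ 2) (3 * n - 2) (2 * n - 1) (n - 1) 3.
Proof.
split.
- exact: Gamma1_order.
- exact: Gamma1_loopless.
- exact: Gamma1_outdegree.
- exact: Gamma1_indegree.
- exact: Gamma1_undirected.
- exact: Gamma1_paths.
Qed.
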